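(* Let $G$ be an abelian group and let $f:G\to\mathbb{C}$ be a local polynomial. For each positive integer $r$ let $$d_f(r)=\sup_{\operatorname{rank} H\leq r}\dim \tau(f|_H)\in[0,+\infty],$$ where the supremum is taken over all finitely generated subgroups $H$ of $G$ of rank at most $r$, and $f|_H$ denotes the restriction of $f$ to $H$. Then: (i) $d_f(r)=+\infty$ for each $r\geq 2$ if and only if $f$ is not a generalized polynomial; (ii) $d_f(r)<+\infty$ for each $r$ and $\lim_{r\to\infty}d_f(r)=+\infty$ if and only if $f$ is a fake polynomial; (iii) $\lim_{r\to\infty}d_f(r)<+\infty$ if and only if $f$ is a polynomial.
   Context: Let $G$ be an abelian group (no topology), written additively. For $y\in G$ and $f:G\to\mathbb{C}$ let $\Delta_y f(x)=f(x+y)-f(x)$, $x\in G$. The following notions are used on $G$ and, likewise, on every subgroup of $G$. A function $f:G\to\mathbb{C}$ is a generalized polynomial if there is a natural number $n$ (with $n=0$ allowed) such that $\Delta_{y_1}\Delta_{y_2}\cdots\Delta_{y_{n+1}}f=0$ for all $y_1,\dots,y_{n+1}\in G$. An additive function on $G$ is a homomorphism from $G$ to the additive group of $\mathbb{C}$. A polynomial on $G$ is a function belonging to the function algebra generated by the additive functions and the constants, i.e. a function of the form $p(x)=P(a_1(x),\dots,a_n(x))$ with additive functions $a_1,\dots,a_n:G\to\mathbb{C}$ and an ordinary complex polynomial $P:\mathbb{C}^n\to\mathbb{C}$. A fake polynomial is a generalized polynomial which is not a polynomial. A local polynomial on $G$ is a function $f:G\to\mathbb{C}$ whose restriction to every finitely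 generated subgroup of $G$ is a polynomial on that subgroup. For a function $f$ on an abelian group $H$, $\tau(f)$ denotes the variety generated by $f$: the smallest translation invariant complex linear subspace of the space of all functions $H\to\mathbb{C}$ that is closed in the topology of pointwise convergence and contains $f$. In particular $\tau(f|_H)$ is the variety generated by $f|_H$ in the space of functions on $H$ (translations by elements of $H$), and $\dim$ is complex dimension. The rank of a finitely generated abelian group $H$ is its torsion-free rank, i.e. the $r$ with $H\cong\mathbb{Z}^r\oplus T$, $T$ finite. The function $d_f$ is increasing (non-decreasing) in $r$, so the limit exists in $[0,+\infty]$. *)

(* Defs.v *)
From HB Require Import structures.
From mathcomp Require Import all_boot all_order all_algebra.
From mathcomp Require Import all_classical all_reals all_analysis.
From mathcomp Require Import complex.
(* Not imported: its notations clash with those of MathComp-Analysis. *)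
From mathcomp Require mpoly.

Set Implicit Arguments.
Unset Strict Implicit.
Unset Printing Implicit Defensive.

Import Order.TTheory GRing.Theory Num.Theory numFieldNormedType.Exports.

Local Open Scope classical_set_scope.
Local Open Scope ring_scope.

(* The subgroup [H] of [G] as an abelian group in its own right, so that every
   notion below, defined for an abstract abelian group, applies to [H]. *)
Definition subgroup (G : zmodType) (H : zmodClosed G) := {x : G | x \in H}.

HB.instance Definition _ (G : zmodType) (H : zmodClosed G) :=
  SubChoice.on (@subgroup G H).
HB.instance Definition _ (G : zmodType) (H : zmodClosed G) :=
  [SubChoice_isSubZmodule of @subgroup G H by <:].

Definition restrict_to (R : realType) (G : zmodType) (H : zmodClosed G)
    (f : G -> R[i]) : subgroup H -> R[i] :=
  fun x => f (val x).

Definition finitely_generated (G : zmodType) : Prop :=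
  exists s : seq G, forall x : G, exists c : 'I_(size s) -> int,
    x = \sum_(j < size s) s`_j *~ c j.

(* [G] is isomorphic to Z^r + T with [T] finite *)
Definition has_rank (G : zmodType) (r : nat) : Prop :=
  exists (T : finZmodType) (phi : {additive G -> 'rV[int]_r * T}),
    bijective phi.

Definition rank_le (G : zmodType) (r : nat) : Prop :=
  exists2 k, (k <= r)%N & has_rank G k.

Definition difference (R : realType) (G : zmodType) (y : G) (f : G -> R[i]) :
    G -> R[i] :=
  fun x => f (x + y) - f x.

Definition generalized_polynomial (R : realType) (G : zmodType)
    (f : G -> R[i]) : Prop :=
  exists n : nat, forall (y : n.+1.-tuple G) (x : G),
    foldr (@difference R G) f y x = 0.

Definition polynomial_function (R : realType) (G : zmodType)
    (f : G -> R[i]) : Prop :=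
  exists (n : nat) (a : 'I_n -> {additive G -> R[i]}) (P : mpoly.mpoly n R[i]),
    forall x : G, f x = mpoly.meval (fun j => a j x) P.

Definition fake_polynomial (R : realType) (G : zmodType)
    (f : G -> R[i]) : Prop :=
  generalized_polynomial f /\ ~ polynomial_function f.

Definition local_polynomial (R : realType) (G : zmodType)
    (f : G -> R[i]) : Prop :=
  forall H : zmodClosed G, finitely_generated (subgroup H) ->
    polynomial_function (@restrict_to R G H f).

(* [R[i]^o] is [R[i]] with its norm topology, and [{ptws _ -> _}] carries the
   topology of pointwise convergence. *)
Definition is_variety (R : realType) (G : zmodType)
    (V : set (G -> R[i])) : Prop :=
  [/\ V 0,
      forall (c : R[i]) (g h : G -> R[i]), V g -> V h -> V (c *: g + h),
      forall (y : G) (g : G -> R[i]), V g -> V (fun x => g (x + y)) &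
      closed (V : set {ptws G -> R[i]^o})].

Definition variety_of (R : realType) (G : zmodType) (f : G -> R[i]) :
    set (G -> R[i]) :=
  smallest (@is_variety R G) [set f].

Definition linearly_independent (R : realType) (X : Type) (n : nat)
    (v : 'I_n -> X -> R[i]) : Prop :=
  forall c : 'I_n -> R[i],
    \sum_(j < n) c j *: v j = 0 -> forall j, c j = 0.

(* Complex dimension of a linear space [V] of functions, infinite exactly when
   [V] contains linearly independent families of every finite size. *)
Definition dimension (R : realType) (X : Type) (V : set (X -> R[i])) : \bar R :=
  ereal_sup [set (n%:R)%:E | n in [set n : nat |
    exists v : 'I_n -> X -> R[i],
      (forall j, V (v j)) /\ linearly_independent v]].

Definition variety_dimension (R : realType) (G : zmodType) (f : G -> R[i])
    (r : nat) : \bar R :=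
  ereal_sup [set d : \bar R | exists H : zmodClosed G,
    [/\ finitely_generated (subgroup H), rank_le (subgroup H) r &
        d = dimension (variety_of (@restrict_to R G H f))]].

Lemma variety_dimension_nondecreasing (R : realType) (G : zmodType)
    (f : G -> R[i]) :
  {homo variety_dimension f : m n / (m <= n)%N >-> (m <= n)%E}.
Proof.
move=> m n le_mn; apply: ereal_sup_le => _ [H [fgH [k le_km rkH] ->]].
by exists H; split=> //; exists k => //; apply: leq_trans le_mn.
Qed.

(* So the [limn] of [variety_dimension f] is a genuine limit. *)
Lemma is_cvgn_variety_dimension (R : realType) (G : zmodType) (f : G -> R[i]) :
  cvgn (variety_dimension f).
Proof.
exact/ereal_nondecreasing_is_cvgn/variety_dimension_nondecreasing.
Qed.

(* Main.v *)
Require Import Defs.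
From HB Require Import structures.
From mathcomp Require Import all_boot all_order all_algebra.
From mathcomp Require Import all_classical all_reals all_analysis.
From mathcomp Require Import complex ring zify fingroup finalg.
From mathcomp Require Import (canonicals) mpoly.
Import Order.TTheory GRing.Theory Num.Theory numFieldNormedType.Exports.
Local Open Scope classical_set_scope.
Local Open Scope ring_scope.

(** Two notions carry the proof: degree (how many differences kill a function)
    and the Levi-Civita equation [f (x + y) = \sum_k u k x * v k y], which says
    that the translates of [f] span a space of finite dimension.

    Degree bounds dimension on groups of bounded rank.  A function of degree
    less than [n] is invariant under torsion and, along each line, a polynomial
    in the number of steps; on a group of rank [k] it is therefore determined by
    its values on an [n ^ k] grid ([degree_lt_independent_le]).  Functions of
    degree less than [n] form a variety, so every [d_f(r)] is finite when [f] is
    a generalized polynomial.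

    Dimension bounds degree already in rank two.  On the subgroup spanned by [x]
    and [y] a local polynomial is killed by some power of the difference along
    [y]; its iterated differences are independent until they vanish, so
    [d_f(2) <= m] forces the [m]-th difference of [f] along every [y] to vanish.
    By polarization ([leading_form_degree]) vanishing along single directions
    lowers the degree below [m] on each finitely generated subgroup, hence on
    [G] ([local_polynomial_degree_lt]).  This gives the first equivalence.

    For the limit, a polynomial satisfies a Levi-Civita equation with some
    number of terms, which bounds the dimension on all subgroups at once
    ([variety_dimension_of_levi_civita]).  Conversely, a uniform bound [m]
    excludes nonsingular minors of size [m + 1] of the kernel [f (x + y)], since
    such a minor would show [m + 1] independent translates on the subgroup
    spanned by its points.  A kernel without large minors has finite rank, so
    [f] satisfies a Levi-Civita equation, and it has bounded degree by the
    preceding paragraph.  Such a function is a polynomial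
    ([polynomial_of_levi_civita]): its leading form is built from additive
    functions, finitely many of which suffice because of the finite rank;
    subtracting the normalized leading form lowers the degree.

    The suprema only range over subgroups for which a rank is exhibited, so the
    argument also needs the structure theorem: a group with [n] generators is
    the product of a free group of rank at most [n] and a finite one
    ([generated_rank_le]). *)

Set Implicit Arguments.
Unset Strict Implicit.
Unset Printing Implicit Defensive.

Lemma fun_addE (R : realType) (X : Type) (f g : X -> R[i]) x :
  (f + g) x = f x + g x.
Proof. by []. Qed.

Lemma fun_oppE (R : realType) (X : Type) (f : X -> R[i]) x : (- f) x = - f x.
Proof. by []. Qed.

Lemma fun_mulE (R : realType) (X : Type) (f g : X -> R[i]) x :
  (f * g) x = f x * g x.
Proof. by []. Qed.

Lemma fun_scaleE (R : realType) (X : Type) (c : R[i]) (f : X -> R[i]) x :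
  (c *: f) x = c * f x.
Proof. by []. Qed.

Definition funE := (fun_addE, fun_oppE, fun_mulE, fun_scaleE).

(** * Functions killed by a fixed number of differences *)

(** Killed by any [n] differences, that is, generalized polynomial of degree
    less than [n]; the shift by one makes the zero function the base case. *)
Fixpoint degree_lt (R : realType) (G : zmodType) (n : nat) (f : G -> R[i]) :
    Prop :=
  if n is n'.+1 then forall y, degree_lt n' (difference y f)
  else forall x, f x = 0.

Section Differences.
Variables (R : realType) (G : zmodType).
Implicit Types (f g h : G -> R[i]) (x y z : G) (c : R[i]) (n m : nat).
Local Notation D := (@difference R G).

Lemma difference_lin y c f g : D y (c *: f + g) = c *: D y f + D y g.
Proof. by apply/funext => x; rewrite /difference !funE; ring. Qed.

Lemma differenceZ y c f : D y (c *: f) = c *: D y f.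
Proof. by apply/funext => x; rewrite /difference !funE; ring. Qed.

Lemma differenceB y f g : D y (f - g) = D y f - D y g.
Proof. by apply/funext => x; rewrite /difference !funE; ring. Qed.

Lemma differenceC y z f : D y (D z f) = D z (D y f).
Proof. by apply/funext => x; rewrite /difference (addrAC x y z); ring. Qed.

(** In terms of translation operators [T], this is
    [T (y + z) - 1 = (T y - 1) + (T z - 1) + (T y - 1) * (T z - 1)]. *)
Lemma difference_addl y z f : D (y + z) f = D y f + D z f + D z (D y f).
Proof.
by apply/funext => x; rewrite /difference !funE (addrAC x z y) addrA; ring.
Qed.

Lemma difference_mul y f g :
  D y (f * g) = D y f * g + f * D y g + D y f * D y g.
Proof. by apply/funext => x; rewrite /difference !funE; ring. Qed.

Lemma iter_differenceC n y z f : iter n (D y) (D z f) = D z (iter n (D y) f).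
Proof. by elim: n => //= n ->; rewrite differenceC. Qed.

Lemma iter_difference_lin n y c f g :
  iter n (D y) (c *: f + g) = c *: iter n (D y) f + iter n (D y) g.
Proof. by elim: n => //= n ->; rewrite difference_lin. Qed.

Lemma iter_differenceD n y f g :
  iter n (D y) (f + g) = iter n (D y) f + iter n (D y) g.
Proof. by rewrite -[f]scale1r iter_difference_lin !scale1r. Qed.

Lemma difference0 y : D y 0 = 0.
Proof. by apply/funext => x; rewrite /difference subrr. Qed.

Lemma iter_difference0 n y : iter n (D y) 0 = 0.
Proof. by elim: n => //= n ->; rewrite difference0. Qed.

Lemma iter_difference_sum (I : Type) (r : seq I) (c : I -> R[i])
    (F : I -> G -> R[i]) n y :
  iter n (D y) (\sum_(i <- r) c i *: F i) =
  \sum_(i <- r) c i *: iter n (D y) (F i).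
Proof.
elim: r => [|i r IH]; first by rewrite !big_nil iter_difference0.
by rewrite !big_cons iter_difference_lin IH.
Qed.

Lemma degree_ltSE n f :
  degree_lt n.+1 f = forall y, degree_lt n (difference y f).
Proof. by []. Qed.

Lemma degree_ltS n f : degree_lt n f -> degree_lt n.+1 f.
Proof.
elim: n f => [|n IH] f /=.
  by move=> f0 y x; rewrite /difference !f0 subrr.
by move=> fn y z; apply: (IH (D y f)); exact: fn.
Qed.

Lemma degree_lt_leq m n f : (m <= n)%N -> degree_lt m f -> degree_lt n f.
Proof.
move=> /subnK <-; elim: (n - m)%N => //= k IH fm.
by apply: degree_ltS; exact: IH.
Qed.

Lemma degree_lt_lin n c f g :
  degree_lt n f -> degree_lt n g -> degree_lt n (c *: f + g).
Proof.
elim: n f g => [|n IH] f g /=.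
  by move=> f0 g0 x; rewrite !funE f0 g0 mulr0 addr0.
by move=> fn gn y; rewrite difference_lin; apply: IH.
Qed.

Lemma degree_lt0 n : degree_lt n (0 : G -> R[i]).
Proof. exact: (@degree_lt_leq 0). Qed.

Lemma degree_ltD n f g :
  degree_lt n f -> degree_lt n g -> degree_lt n (f + g).
Proof. by move=> fn gn; rewrite -[f]scale1r; exact: degree_lt_lin. Qed.

Lemma degree_ltZ n c f : degree_lt n f -> degree_lt n (c *: f).
Proof.
move=> fn; rewrite -[_ *: _]addr0; apply: degree_lt_lin => //.
exact: degree_lt0.
Qed.

Lemma degree_lt_sum (I : Type) (r : seq I) (P : pred I) (F : I -> G -> R[i]) n :
  (forall i, P i -> degree_lt n (F i)) -> degree_lt n (\sum_(i <- r | P i) F i).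
Proof.
by move=> Fn; apply: big_ind => //; [exact: degree_lt0|exact: degree_ltD].
Qed.

Lemma degree_lt_shift n y f : degree_lt n f -> degree_lt n (fun x => f (x + y)).
Proof.
elim: n f => [|n IH] f /=; first by move=> f0 x; exact: f0.
move=> fn z; rewrite (_ : D z _ = fun x => D z f (x + y)); first exact: IH.
by apply/funext => x; rewrite /difference addrAC.
Qed.

Lemma degree_lt_iter k n y f :
  degree_lt (n + k) f -> degree_lt n (iter k (D y) f).
Proof.
elim: k f => [|k IH] f; first by rewrite addn0.
by rewrite addnS iterSr => fnk; apply: IH; exact: fnk.
Qed.

Lemma degree_lt_eq0 n f : degree_lt n f -> forall y x, iter n (D y) f x = 0.
Proof. by move=> fn y; exact: (@degree_lt_iter n 0). Qed.

Lemma degree_lt1P f : degree_lt 1 f -> forall x, f x = f 0.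
Proof.
by move=> f1 x; apply/eqP; rewrite -subr_eq0 -{1}[x]add0r; apply/eqP/f1.
Qed.

Lemma degree_lt_cst n c : degree_lt n.+1 (fun _ : G => c).
Proof.
by apply: (@degree_lt_leq 1) => // y x /=; rewrite /difference subrr.
Qed.

Lemma degree_lt_foldrP n f :
  degree_lt n f <-> forall s : seq G, size s = n -> forall x, foldr D f s x = 0.
Proof.
elim: n f => [|n IH] f /=.
  by split=> [f0 s /size0nil -> //|/(_ [::]) /= /(_ erefl)].
split=> [fn|fn y].
  case/lastP => // s y; rewrite size_rcons => -[sn] x; rewrite foldr_rcons.
  by apply: (IH _).1.
by apply/IH => s sn x; rewrite -foldr_rcons fn// size_rcons sn.
Qed.

Lemma generalized_polynomialP f :
  generalized_polynomial f <-> exists n, degree_lt n f.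
Proof.
split=> -[n fn]; [exists n.+1|exists n].
  apply/degree_lt_foldrP => s sn x.
  by have := fn (tcast sn (in_tuple s)) x; rewrite val_tcast.
move=> y x; move: fn => /degree_ltS/degree_lt_foldrP; apply.
by rewrite size_tuple.
Qed.

Lemma degree_ltM m n f g :
  degree_lt m f -> degree_lt n g -> degree_lt (m + n) (f * g).
Proof.
have [k] := ubnP (m + n); elim: k m n f g => // k IH [|m] [|n] f g;
    rewrite ?ltnS => kmn fm gn.
- by move=> x; rewrite !funE fm mul0r.
- by apply: (@degree_lt_leq 0) => // x; rewrite !funE fm mul0r.
- by apply: (@degree_lt_leq 0) => // x; rewrite !funE gn mulr0.
rewrite addSn addnS degree_ltSE => y; rewrite difference_mul.
rewrite addSn addnS in kmn.
apply: degree_ltD; first apply: degree_ltD.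
- by rewrite -addnS; apply: IH; rewrite ?addnS.
- by rewrite -addSn; apply: IH; rewrite ?addSn.
by apply: degree_ltS; apply: IH => //; exact: ltnW.
Qed.

(** * The top-degree part of a generalized polynomial *)

(** For [f] of degree at most [n], the [n]-fold difference of [f] is a constant
    symmetric [n]-additive form; this is its diagonal, and [n`!] times the
    homogeneous component of degree [n] of [f]. *)
Definition leading_form n f : G -> R[i] := fun x => iter n (D x) f 0.

Lemma leading_formS n f x : leading_form n.+1 f x = leading_form n (D x f) x.
Proof. by rewrite /leading_form iterSr. Qed.

(** The binomial formula for [D (x + y) = D x + D y + D y * D x]: the last term
    is of order two and contributes nothing to an [n]-fold product acting on
    degree at most [n]. *)
Lemma iter_difference_addl n x y f : degree_lt n.+1 f ->
  iter n (D (x + y)) f =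
  \sum_(k < n.+1) ('C(n, k)%:R : R[i]) *: iter (n - k) (D x) (iter k (D y) f).
Proof.
elim: n f => [|n IH] f fn; first by rewrite big_ord1 /= bin0 scale1r.
rewrite iterSr IH; last exact: fn.
pose a k := iter (n.+1 - k) (D x) (iter k (D y) f).
have split_term k : (k <= n)%N ->
    iter (n - k) (D x) (iter k (D y) (D (x + y) f)) = a k + a k.+1.
  move=> kn; rewrite difference_addl 4!iter_differenceD.
  have -> : iter (n - k) (D x) (iter k (D y) (D y (D x f))) = 0.
    apply/funext; apply: degree_lt_eq0; apply: degree_lt_iter.
    by rewrite subnK//; exact: fn.
  rewrite addr0 /a subSS -iterSr; congr (_ + _).
  by rewrite iter_differenceC subSn// iterSr.
under eq_bigr => k _ do rewrite split_term -1?ltnS// scalerDr.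
rewrite big_split/= [RHS]big_ord_recl/=.
under [in RHS]eq_bigr => k _ do rewrite /bump/= add1n binS natrD scalerDl.
rewrite big_split/= addrA; congr (_ + _).
transitivity (\sum_(k < n.+2) ('C(n, k)%:R : R[i]) *: a k).
  by rewrite [RHS]big_ord_recr/= bin_small// scale0r addr0.
by rewrite big_ord_recl !bin0.
Qed.

(** Up to lower degree, differentiating the leading form gives [n.+1] times the
    leading form of the difference, as for a homogeneous polynomial. *)
Lemma difference_leading_form n y f : degree_lt n.+2 f ->
  D y (leading_form n.+1 f) =
  n.+1%:R *: leading_form n (D y f) +
  \sum_(k < n) ('C(n.+1, k.+2)%:R : R[i]) *:
     leading_form (n.+1 - k.+2) (iter k.+2 (D y) f).
Proof.
move=> fn; apply/funext => x; rewrite {1}/difference /leading_form.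
rewrite iter_difference_addl// 2!big_ord_recl/= !funE !fct_sumE.
rewrite bin0 mul1r addrC addKr bin1 subn1/=; by congr (_ + _).
Qed.

(** Polarization: [n`!] times [f] and its leading form have the same [n]-fold
    difference, so subtracting one from the other lowers the degree. *)
Lemma leading_form_degree n f : degree_lt n.+1 f ->
  degree_lt n.+1 (leading_form n f) /\
  degree_lt n ((n`!)%:R *: f - leading_form n f).
Proof.
have [m] := ubnP n; elim: m n f => // m IH [|n] f nm fn.
  split; first exact: degree_lt_cst.
  move=> x; rewrite /leading_form/= !funE fact0 (degree_lt1P fn).
  by rewrite mul1r subrr.
pose h y := \sum_(k < n) ('C(n.+1, k.+2)%:R : R[i]) *:
  leading_form (n.+1 - k.+2) (iter k.+2 (D y) f).
have hn y : degree_lt n (h y).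
  apply: degree_lt_sum => k _; apply: degree_ltZ.
  have kn := ltn_ord k.
  have sub_lt : ((n - k.+1).+1 <= n)%N by rewrite ltn_subrL (leq_trans _ kn).
  have lt_m : (n - k.+1 < m)%N by apply: leq_trans sub_lt _; rewrite -ltnS ltnW.
  rewrite subSS; apply: (degree_lt_leq sub_lt); apply: (IH _ _ lt_m _).1.
  by apply: degree_lt_iter; rewrite addSn addnS subnK.
have dn y := IH n (D y f) nm (fn y).
split; rewrite degree_ltSE => y.
  rewrite difference_leading_form//.
  apply: degree_lt_lin; first exact: (dn y).1.
  exact: degree_ltS (hn y).
rewrite (_ : D y _ =
    n.+1%:R *: ((n`!)%:R *: D y f - leading_form n (D y f)) - h y).
  apply: degree_ltD; first by apply: degree_ltZ; exact: (dn y).2.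
  by rewrite -scaleN1r; apply: degree_ltZ; exact: hn.
rewrite differenceB differenceZ difference_leading_form// -/(h y) factS natrM.
by apply/funext => x; rewrite !funE; ring.
Qed.

End Differences.

(** A function whose [n]-fold differences vanish along single directions has
    zero leading form in every degree at least [n], so its degree can be lowered
    until it is less than [n]. *)
Lemma degree_lt_iter0 (R : realType) (G : zmodType) n d (f : G -> R[i]) :
  degree_lt d f -> (forall y x, iter n (difference y) f x = 0) -> degree_lt n f.
Proof.
move=> fd fn; elim: d fd => [|d IH] fd; first exact: degree_lt_leq fd.
have [dn|nd] := leqP d.+1 n; first exact: degree_lt_leq fd.
apply: IH; have [_] := leading_form_degree fd.
rewrite (_ : leading_form d f = 0) => [|].
  rewrite subr0 => /(degree_ltZ (d`!)%:R^-1).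
  rewrite scalerA mulVf ?scale1r// pnatr_eq0 -lt0n; exact: fact_gt0.
apply/funext => x; rewrite /leading_form -(subnK (nd : (n <= d)%N)) iterD.
by rewrite (_ : iter n _ f = 0) ?iter_difference0//; apply/funext/fn.
Qed.

(** * Kernels of finite rank *)

(** Grow a nonsingular minor by one row and one column at a time.  The bordered
    minor is singular for every choice of the new row and column only if all
    Schur complements vanish, and this is the formula that recovers the kernel
    from the rows and columns of the minor. *)
Lemma minor_or_skeleton (F : fieldType) (X Y : Type) (K : X -> Y -> F) m :
  (exists (x : 'I_m -> X) (y : 'I_m -> Y),
     (\matrix_(i, j) K (x i) (y j)) \in unitmx) \/
  exists (p : nat) (x : 'I_p -> X) (y : 'I_p -> Y) (M : 'M[F]_p),
    (p < m)%N /\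
    forall s t, K s t = \sum_k (\sum_l K s (y l) * M l k) * K (x k) t.
Proof.
elim: m => [|m [[x [y]]|[p [x [y [M [pm KE]]]]]]].
- left.
  exists (fun i : 'I_0 => let: Ordinal _ h := i in False_rect _ (notF h)).
  exists (fun i : 'I_0 => let: Ordinal _ h := i in False_rect _ (notF h)).
  by rewrite unitmxE det_mx00 unitr1.
- set A := (\matrix_(i, j) _) => Au.
  have [KE|] := pselect (forall s t,
      K s t = \sum_k (\sum_l K s (y l) * invmx A l k) * K (x k) t).
    by right; exists m, x, y, (invmx A); rewrite ltnSn.
  move=> /existsNP[s /existsNP[t Kst]]; left.
  pose add (T : Type) (z : 'I_m -> T) z0 (i : 'I_m.+1) :=
    oapp z z0 (unlift ord0 i).
  exists (add _ x s), (add _ y t).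
  pose a : 'M[F]_1 := (K s t)%:M.
  pose r : 'rV[F]_m := \row_j K s (y j).
  pose c : 'cV[F]_m := \col_i K (x i) t.
  have -> : (\matrix_(i, j) K (add _ x s i) (add _ y t j) : 'M[F]_(1 + m)) =
      block_mx a r c A.
    apply/matrixP => i j; rewrite !mxE /add.
    case: (splitP i) => i' ii'; rewrite !mxE; case: (splitP j) => j' jj';
      rewrite !mxE ?(ord1 i') ?(ord1 j') in ii' jj' *.
    - have -> : i = ord0 by apply/val_inj.
      have -> : j = ord0 by apply/val_inj.
      by rewrite unlift_none.
    - have -> : i = ord0 by apply/val_inj.
      have -> : j = lift ord0 j' by apply/val_inj.
      by rewrite unlift_none liftK.
    - have -> : i = lift ord0 i' by apply/val_inj.
      have -> : j = ord0 by apply/val_inj.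
      by rewrite unlift_none liftK.
    - have -> : i = lift ord0 i' by apply/val_inj.
      have -> : j = lift ord0 j' by apply/val_inj.
      by rewrite !liftK.
  have elim_c : block_mx a r c A *m block_mx 1%:M 0 (- (invmx A *m c)) 1%:M =
      block_mx (a - r *m invmx A *m c) r 0 A.
    rewrite mulmx_block !mulmx1 !mulmx0 !mulmxN !mulmxA !add0r mulmxV//.
    by rewrite mul1mx subrr.
  have := congr1 determinant elim_c.
  rewrite det_mulmx det_lblock !det1 !mulr1 det_ublock unitmxE unitfE => ->.
  rewrite mulf_neq0//; last by rewrite -unitfE -unitmxE.
  rewrite det_mx11 !mxE subr_eq0; apply/eqP => E; apply: Kst.
  rewrite mulr1n in E; rewrite {}E; apply: eq_bigr => k _; rewrite !mxE.
  by congr (_ * _); apply: eq_bigr => l _; rewrite mxE.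
- by right; exists p, x, y, M; split=> //; exact: leqW.
Qed.

Definition finite_rank (F : fieldType) (X Y : Type) (K : X -> Y -> F) : Prop :=
  exists (I : finType) (u : I -> X -> F) (v : I -> Y -> F),
    forall x y, K x y = \sum_i u i x * v i y.

Section FiniteRank.
Variables (F : fieldType) (X Y : Type).
Implicit Types K L : X -> Y -> F.

Lemma factorization_skeleton (I : finType) (u : I -> X -> F) (v : I -> Y -> F)
    K :
  (forall x y, K x y = \sum_i u i x * v i y) ->
  exists (p : nat) (x : 'I_p -> X) (y : 'I_p -> Y) (M : 'M[F]_p),
    (p <= #|I|)%N /\
    forall s t, K s t = \sum_k (\sum_l K s (y l) * M l k) * K (x k) t.
Proof.
move=> KE; have [[x [y]]|//] := minor_or_skeleton K #|I|.+1.
rewrite -row_free_unit /row_free => /eqP rk; exfalso.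
have := leq_trans (mxrankM_maxl
  (\matrix_(i < #|I|.+1, k < #|I|) u (enum_val k) (x i))
  (\matrix_(k < #|I|, j < #|I|.+1) v (enum_val k) (y j))) (rank_leq_col _).
rewrite leqNgt => /negP; apply.
rewrite (_ : _ *m _ = \matrix_(i, j) K (x i) (y j)); first by rewrite rk.
apply/matrixP => i j; rewrite !mxE KE (reindex (enum_val : 'I_#|I| -> I))/=.
  by apply: eq_bigr => k _; rewrite !mxE.
by exists enum_rank => k _; [exact: enum_valK|exact: enum_rankK].
Qed.

Lemma finite_rank_l (a : X -> F) : finite_rank (fun x (_ : Y) => a x).
Proof.
exists unit, (fun=> a), (fun _ _ => 1) => x y.
by rewrite big_const card_unit/= mulr1 addr0.
Qed.

Lemma finite_rank_r (a : Y -> F) : finite_rank (fun (_ : X) y => a y).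
Proof.
exists unit, (fun _ _ => 1), (fun=> a) => x y.
by rewrite big_const card_unit/= mul1r addr0.
Qed.

Lemma finite_rankD K L :
  finite_rank K -> finite_rank L -> finite_rank (fun x y => K x y + L x y).
Proof.
move=> [I [u [v KE]]] [J [w [z LE]]]; exists (I + J)%type.
exists (fun k => match k with inl i => u i | inr j => w j end).
exists (fun k => match k with inl i => v i | inr j => z j end) => x y.
by rewrite big_sumType /= KE LE.
Qed.

Lemma finite_rankM K L :
  finite_rank K -> finite_rank L -> finite_rank (fun x y => K x y * L x y).
Proof.
move=> [I [u [v KE]]] [J [w [z LE]]]; exists (I * J)%type.
exists (fun k => u k.1 \* w k.2), (fun k => v k.1 \* z k.2) => x y.
rewrite KE LE big_distrlr pair_bigA/=; apply: eq_bigr => k _.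
by rewrite mulrACA.
Qed.
End FiniteRank.

Lemma finite_rank_comp (F : fieldType) (X Y X' Y' : Type) (K : X -> Y -> F)
    (p : X' -> X) (q : Y' -> Y) :
  finite_rank K -> finite_rank (fun x y => K (p x) (q y)).
Proof.
move=> [I [u [v KE]]].
by exists I, (fun i => u i \o p), (fun i => v i \o q) => x y; rewrite KE.
Qed.

(** * Polynomials *)

Lemma additive_of (U V : zmodType) (f : U -> V) :
  {morph f : x y / x + y} -> exists a : {additive U -> V}, a =1 f.
Proof.
move=> fD; have fB : {morph f : x y / x - y}.
  by move=> x y; apply: (addIr (f y)); rewrite -fD !subrK.
pose fM := GRing.isZmodMorphism.Build U V f fB.
by exists (HB.pack f fM : {additive U -> V}).
Qed.

Section Polynomials.
Variables (R : realType) (G : zmodType).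
Implicit Types f g : G -> R[i].

Lemma polynomial_function_ind (Q : (G -> R[i]) -> Prop) :
  (forall c, Q (fun=> c)) -> (forall a : {additive G -> R[i]}, Q a) ->
  (forall f g, Q f -> Q g -> Q (f + g)) ->
  (forall f g, Q f -> Q g -> Q (f * g)) ->
  forall f, polynomial_function f -> Q f.
Proof.
move=> Qc Qa QD QM f [n [a [P fE]]].
have Q1 : Q 1 by exact: Qc.
have QX g k : Q g -> Q (g ^+ k).
  by move=> Qg; elim: k => [|k IH]; rewrite ?expr0// exprS; exact: QM.
rewrite (_ : f = \sum_(m <- mpoly.msupp P)
    (fun=> mpoly.mcoeff m P) *
    \prod_i ((a i : G -> R[i]) ^+ mpoly.fun_of_multinom m i)).
  apply: (big_ind Q); [exact: Qc|exact: QD|move=> m _].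
  apply: (QM) => //; apply: (big_ind Q) => [|g h|i _].
  - exact: Q1.
  - exact: QM.
  - exact: QX.
apply/funext => x; rewrite fE mpoly.mevalE fct_sumE; apply: eq_bigr => m _.
rewrite funE fct_prodE; congr (_ * _); apply: eq_bigr => i _.
by rewrite exprfctE.
Qed.

Lemma polynomial_function_cst c : polynomial_function (fun _ : G => c : R[i]).
Proof.
exists 0%N, (fun=> [the {additive G -> R[i]} of \0]), (mpoly.mpolyC _ c) => x.
by rewrite mpoly.mevalC.
Qed.

Lemma polynomial_function_additive (a : {additive G -> R[i]}) :
  polynomial_function a.
Proof.
exists 1%N, (fun=> a), (mpoly.mpolyX _ (mpoly.mnm1 ord0)) => x.
by rewrite mpoly.mevalXU.
Qed.

Lemma polynomial_function_common f g :
  polynomial_function f -> polynomial_function g ->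
  exists n (a : 'I_n -> {additive G -> R[i]}) (P Q : mpoly.mpoly n R[i]),
    (forall x, f x = mpoly.meval (fun j => a j x) P) /\
    (forall x, g x = mpoly.meval (fun j => a j x) Q).
Proof.
move=> [m [a [P fE]]] [n [b [Q gE]]]; exists (m + n)%N.
exists (fun k => match fintype.split k with inl i => a i | inr j => b j end).
pose X k := mpoly.mpolyX R[i] (mpoly.mnm1 (k : 'I_(m + n))).
exists (mpoly.comp_mpoly [tuple X (lshift n i) | i < m] P).
exists (mpoly.comp_mpoly [tuple X (rshift m i) | i < n] Q).
split=> x; rewrite mpoly.comp_mpoly_meval ?fE ?gE; apply: mpoly.meval_eq => i.
  by rewrite tnth_mktuple mpoly.mevalXU (unsplitK (inl _ i)).
by rewrite tnth_mktuple mpoly.mevalXU (unsplitK (inr _ i)).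
Qed.

Lemma polynomial_functionD f g : polynomial_function f ->
  polynomial_function g -> polynomial_function (f + g).
Proof.
move=> pf pg; have [n [a [P [Q [fE gE]]]]] := polynomial_function_common pf pg.
by exists n, a, (P + Q) => x; rewrite mpoly.mevalD funE fE gE.
Qed.

Lemma polynomial_functionM f g : polynomial_function f ->
  polynomial_function g -> polynomial_function (f * g).
Proof.
move=> pf pg; have [n [a [P [Q [fE gE]]]]] := polynomial_function_common pf pg.
by exists n, a, (P * Q) => x; rewrite mpoly.mevalM funE fE gE.
Qed.

Lemma polynomial_function_sum (I : Type) (r : seq I) (F : I -> G -> R[i]) :
  (forall i, polynomial_function (F i)) ->
  polynomial_function (\sum_(i <- r) F i).
Proof.
move=> pF; apply: (big_ind (@polynomial_function R G)) => [|f g|i _] //.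
  exact: polynomial_function_cst.
exact: polynomial_functionD.
Qed.

Lemma polynomial_function_degree_lt f :
  polynomial_function f -> exists n, degree_lt n f.
Proof.
apply: (@polynomial_function_ind (fun f => exists n, degree_lt n f)) => {f}
  [c|a|f g [m fm] [n gn]|f g [m fm] [n gn]].
- by exists 1%N; exact: degree_lt_cst.
- exists 2%N => y z x; rewrite /difference !(raddfD a); ring.
- exists (m + n)%N; apply: degree_ltD.
    by apply: degree_lt_leq fm; exact: leq_addr.
  by apply: degree_lt_leq gn; exact: leq_addl.
- by exists (m + n)%N; exact: degree_ltM.
Qed.

(** The Levi-Civita functional equation: the translates of [f] span a space of
    finite dimension. *)
Definition levi_civita f : Prop := finite_rank (fun x y => f (x + y)).

Lemma levi_civitaD f g : levi_civita f -> levi_civita g -> levi_civita (f + g).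
Proof. exact: finite_rankD. Qed.

Lemma levi_civitaM f g : levi_civita f -> levi_civita g -> levi_civita (f * g).
Proof. exact: finite_rankM. Qed.

Lemma polynomial_function_levi_civita f :
  polynomial_function f -> levi_civita f.
Proof.
apply: (@polynomial_function_ind levi_civita) => {f} [c|a||].
- exact: finite_rank_l.
- rewrite /levi_civita.
  under eq_fun => x do under eq_fun => y do rewrite (raddfD a).
  by apply: finite_rankD; [exact: finite_rank_l|exact: finite_rank_r].
- exact: levi_civitaD.
- exact: levi_civitaM.
Qed.

Lemma levi_civita_difference y f :
  levi_civita f -> levi_civita (difference y f).
Proof.
move=> lf; rewrite (_ : difference y f = (fun x => f (x + y)) + (fun=> -1) * f).
  apply: levi_civitaD; last by apply: levi_civitaM => //; exact: finite_rank_l.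
  rewrite /levi_civita.
  under eq_fun => x do under eq_fun => z do rewrite -addrA.
  exact: (finite_rank_comp id (fun z => z + y) lf).
by apply/funext => x; rewrite !funE mulN1r.
Qed.

(** The function [y => leading_form n (D y f)] is additive modulo lower degree,
    which [leading_form n] does not see.  Finite rank lets finitely many of
    these additive functions generate all of them, so the recursion
    [leading_form n.+1 f x = leading_form n (D x f) x] stays within the
    polynomials. *)
Lemma polynomial_function_leading_form n f : degree_lt n.+1 f ->
  levi_civita f -> polynomial_function (leading_form n f).
Proof.
elim: n f => [|n IH] f fn lf; first exact: polynomial_function_cst.
pose K y x := leading_form n (difference y f) x.
have [I [u [v fE]]] := lf.
have KE y x : K y x = \sum_i (v i y - v i 0) * leading_form n (u i) x.
  rewrite /K /leading_form.
  have -> : difference y f = \sum_i (v i y - v i 0) *: u i.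
    apply/funext => z; rewrite /difference fE -[in f z](addr0 z) fE.
    rewrite -sumrB fct_sumE.
    by apply: eq_bigr => i _; rewrite funE -mulrBr mulrC.
  rewrite iter_difference_sum fct_sumE.
  by apply: eq_bigr => i _; rewrite funE.
have [p [x [y [M [_ {}KE]]]]] := factorization_skeleton KE.
have K_additive k : exists a : {additive G -> R[i]}, a =1 K^~ (y k).
  apply: additive_of => b c.
  rewrite /K difference_addl /leading_form 2!iter_differenceD !funE.
  have := @degree_lt_eq0 _ _ n (difference c (difference b f)) (fn b c).
  by move=> ->; rewrite addr0.
have [a aE] := choice K_additive.
rewrite (_ : leading_form n.+1 f =
    \sum_k (\sum_l (a l : G -> R[i]) * (fun=> M l k)) * K (x k)).
  apply: polynomial_function_sum => k; apply: polynomial_functionM.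
    apply: polynomial_function_sum => l; apply: polynomial_functionM.
      exact: polynomial_function_additive.
    exact: polynomial_function_cst.
  by apply: IH; [exact: fn|exact: levi_civita_difference].
apply/funext => z; rewrite leading_formS -/(K z z) KE fct_sumE.
apply: eq_bigr => k _; rewrite funE fct_sumE; congr (_ * _).
by apply: eq_bigr => l _; rewrite funE aE.
Qed.

(** Induction on the degree: the leading form is a polynomial, hence satisfies a
    Levi-Civita equation, and so does the remainder, of smaller degree. *)
Lemma polynomial_of_levi_civita n f :
  degree_lt n f -> levi_civita f -> polynomial_function f.
Proof.
elim: n f => [|n IH] f fn lf.
  by rewrite (_ : f = fun=> 0); [exact: polynomial_function_cst|exact/funext].
have pq := polynomial_function_leading_form fn lf.
have [_ gn] := leading_form_degree fn.
set g := _ - _ in gn.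
have lg : levi_civita g.
  rewrite (_ : g = (fun=> (n`!)%:R) * f + (fun=> -1) * leading_form n f).
    apply: levi_civitaD; apply: levi_civitaM => //; try exact: finite_rank_l.
    exact: polynomial_function_levi_civita.
  by apply/funext => x; rewrite !funE mulN1r.
have nf0 : (n`!)%:R != 0 :> R[i] by rewrite pnatr_eq0 -lt0n fact_gt0.
rewrite (_ : f = (fun=> (n`!)%:R^-1) * (g + leading_form n f)).
  apply: polynomial_functionM; first exact: polynomial_function_cst.
  by apply: polynomial_functionD => //; exact: IH.
by rewrite subrK; apply/funext => x; rewrite !funE mulrA mulVf// mul1r.
Qed.

End Polynomials.

(** * Finitely generated abelian groups *)

Definition torsion (A : zmodType) : {pred A} :=
  fun x => `[< exists2 m : nat, (0 < m)%N & x *+ m = 0 >].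

Lemma torsionP (A : zmodType) (x : A) :
  reflect (exists2 m : nat, (0 < m)%N & x *+ m = 0) (x \in @torsion A).
Proof. exact: asboolP. Qed.

Lemma torsion_zmod_closed (A : zmodType) : zmod_closed (@torsion A).
Proof.
split; first by apply/torsionP; exists 1%N.
move=> x y /torsionP[m m0 xm] /torsionP[n n0 yn]; apply/torsionP.
exists (m * n)%N; first by rewrite muln_gt0 m0.
by rewrite mulrnBl mulrnA xm mul0rn mulnC mulrnA yn mul0rn subrr.
Qed.

HB.instance Definition _ (A : zmodType) :=
  GRing.isZmodClosed.Build A (@torsion A) (@torsion_zmod_closed A).

Lemma torsionMz (A : zmodType) (x : A) (a : int) :
  a != 0 -> x *~ a \in @torsion A -> x \in @torsion A.
Proof.
move=> a0 /torsionP[m m0 xam]; apply/torsionP; exists (`|a| * m)%N.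
  by rewrite muln_gt0 absz_gt0 a0.
rewrite mulrnA; case: a xam {a0} => k //=.
by rewrite NegzE mulrNz mulNrn => /eqP; rewrite oppr_eq0 => /eqP.
Qed.

Section Combinations.
Variable (A : zmodType).

Definition combination n (g : 'I_n -> A) (c : 'rV[int]_n) : A :=
  \sum_j g j *~ c 0 j.

Lemma combinationB n (g : 'I_n -> A) : {morph combination g : c d / c - d}.
Proof.
move=> c d; rewrite /combination -sumrB; apply: eq_bigr => j _.
by rewrite !mxE mulrzBr.
Qed.

Lemma combination0 n (g : 'I_n -> A) : combination g 0 = 0.
Proof. by rewrite /combination big1// => j _; rewrite mxE mulr0z. Qed.

Lemma combinationD n (g : 'I_n -> A) : {morph combination g : c d / c + d}.
Proof.
move=> c d; rewrite /combination -big_split; apply: eq_bigr => j _.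
by rewrite mxE mulrzDr.
Qed.

Lemma combinationZ n (g : 'I_n -> A) a c :
  combination g (a *: c) = combination g c *~ a.
Proof.
rewrite /combination mulrz_suml; apply: eq_bigr => j _.
by rewrite mxE mulrC mulrzA.
Qed.

Lemma combination_mul m n (g : 'I_n -> A) (M : 'M[int]_(m, n)) c :
  combination g (c *m M) = combination (fun i => combination g (row i M)) c.
Proof.
rewrite /combination.
under [RHS]eq_bigr => i _ do rewrite mulrz_suml.
rewrite [RHS]exchange_big/=; apply: eq_bigr => j _; rewrite mxE mulrz_sumr.
by apply: eq_bigr => i _; rewrite !mxE mulrC mulrzA.
Qed.

Definition generates_mod_torsion n (g : 'I_n -> A) : Prop :=
  forall x, exists c, x - combination g c \in @torsion A.

(** A combination [c != 0] of [g] that is torsion is, in a basis of [Z^n] given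
    by the Smith form of [c], a multiple of one new generator, which is then
    torsion and can be dropped. *)
Lemma free_mod_torsion n (g : 'I_n -> A) : generates_mod_torsion g ->
  exists (k : nat) (e : 'I_k -> A), [/\ (k <= n)%N, generates_mod_torsion e &
    forall c, combination e c \in @torsion A -> c = 0].
Proof.
elim: n g => [|n IH] g gen.
  by exists 0%N, g; split=> // c _; exact: thinmx0.
have [free|] := pselect (forall c, combination g c \in @torsion A -> c = 0).
  by exists n.+1, g.
move=> /existsNP[c /not_implyP[tc /eqP c0]].
have [L Lu [M Mu [d _ cE]]] := int_Smith_normal_form c.
have {}cE : c = (L 0 0 * d`_0) *: row 0 M.
  apply/rowP => j; rewrite {1}cE !mxE big_ord_recl big1 => [|i _].
    by rewrite addr0 !mxE big_ord1 !mxE eqxx mulr1n.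
  by rewrite !mxE big_ord1 !mxE/= mulr0n mulr0 mul0r.
have t0 : combination g (row 0 M) \in @torsion A.
  move: tc; rewrite cE combinationZ; apply: torsionMz.
  by apply: contraNneq c0 => a0; rewrite cE a0 scale0r.
have [|k [e [kn gene freee]]] :=
    IH (fun j => combination g (row (lift ord0 j) M)).
  move=> x; have [b tb] := gen x.
  exists (\row_j (b *m invmx M) 0 (lift ord0 j)).
  rewrite -[b](mulmxKV Mu) combination_mul {1}/combination big_ord_recl in tb.
  rewrite (_ : x - _ = x -
      (combination g (row ord0 M) *~ (b *m invmx M) 0 ord0 +
      \sum_(i < n) combination g (row (lift ord0 i) M) *~
        (b *m invmx M) 0 (lift ord0 i)) +
      combination g (row ord0 M) *~ (b *m invmx M) 0 ord0).
    by apply: rpredD => //; exact: rpredMz.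
  rewrite opprD addrA addrAC subrK /combination; congr (_ - _).
  by apply: eq_bigr => j _; rewrite mxE.
by exists k, e; split=> //; exact: leqW.
Qed.
End Combinations.

(** An enumeration turns the torsion subgroup, a subtype of a group that may be
    infinite, into a finite type. *)
Section FiniteZmod.
Variables (A : zmodType) (s : seq A) (s_all : forall x, x \in s).

(** The vacuous binding makes the proof [s_all] part of the type, so that the
    finite structure below can be found from the type alone. *)
Definition finite_zmod : Type := let _ := s_all in A.

HB.instance Definition _ := GRing.Zmodule.copy finite_zmod A.

Lemma finite_zmod_pickleK :
  pcancel (fun x : finite_zmod => index (x : A) s) (onth s).
Proof. by move=> x; rewrite onthE (nth_map (0 : A)) ?index_mem ?nth_index. Qed.

HB.instance Definition _ := PCanIsCountable finite_zmod_pickleK.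

Lemma finite_zmod_enumP : Finite.axiom (undup s : seq finite_zmod).
Proof. by move=> x; rewrite count_uniq_mem ?undup_uniq// mem_undup s_all. Qed.

HB.instance Definition _ :=
  fintype.isFinite.Build finite_zmod finite_zmod_enumP.

End FiniteZmod.

Lemma mulrz_modz (A : zmodType) (t : A) (m : nat) (a : int) :
  (0 < m)%N -> t *+ m = 0 -> t *~ a = t *+ `|(a %% m)%Z|%N.
Proof.
move=> m0 tm; rewrite [in LHS](divz_eq a m) mulrzDr mulrC mulrzA -pmulrn tm.
rewrite mul0rz add0r.
by rewrite pmulrn gez0_abs// modz_ge0//; lia.
Qed.

Section Structure.
Variables (A : zmodType) (n : nat) (g : 'I_n -> A).
Hypothesis gen : forall x, exists c, x = combination g c.

Let gen_torsion : generates_mod_torsion g.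
Proof. by move=> x; have [c ->] := gen x; exists c; rewrite subrr rpred0. Qed.

(** Modulo the free part each generator [g j] is a torsion element [t j], and a
    torsion element is a combination of the [t j], whose coefficients matter
    only modulo the orders. *)
Lemma torsion_finite :
  exists s : seq (subgroup (@torsion A)), forall x, x \in s.
Proof.
have [k [e [_ gene freee]]] := free_mod_torsion gen_torsion.
have [d dE] := choice (fun j => gene (g j)).
pose t j := g j - combination e (d j).
have tP j : exists m : nat, (0 < m)%N /\ t j *+ m = 0.
  by have /torsionP[m m0 tm] := dE j; exists m.
have [m mP] := choice tP.
pose B := \max_j m j.
pose s0 := [seq \sum_j t j *+ (k j : nat) | k : {ffun 'I_n -> 'I_B.+1}].
exists (pmap insub s0) => x; rewrite mem_pmap_sub/=.
have [c xE] := gen (val x).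
pose M := \matrix_i d i.
have xM : val x = combination e (c *m M) + \sum_j t j *~ c ord0 j.
  rewrite xE combination_mul /combination -big_split/=; apply: eq_bigr => j _.
  by rewrite -mulrzDl rowK /t addrC subrK.
have cM0 : c *m M = 0.
  apply: freee; rewrite (_ : combination _ _ = val x - \sum_j t j *~ c ord0 j).
    apply: rpredB; first exact: valP.
    by apply: rpred_sum => j _; apply: rpredMz; exact: dE.
  by rewrite xM addrK.
rewrite {}xM {}cM0 combination0 add0r.
have ltB j : (`|(c ord0 j %% m j)%Z| < B.+1)%N.
  have [m0 _] := mP j; rewrite ltnS; apply: leq_trans (leq_bigmax j).
  have mj : 0 < m j :> int by [].
  have := ltz_pmod (c ord0 j) mj; have := modz_ge0 (c ord0 j) (lt0r_neq0 mj).
  lia.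
apply/mapP; exists [ffun j => Ordinal (ltB j)]; first by rewrite mem_enum.
apply: eq_bigr => j _; have [m0 tm] := mP j.
by rewrite ffunE/= (mulrz_modz _ m0 tm).
Qed.

(** The free coordinates of an element are unique because free combinations are
    never torsion; the torsion remainder is the other component. *)
Lemma generated_rank_le : rank_le A n.
Proof.
have [s s_all] := torsion_finite.
have [k [e [kn gene freee]]] := free_mod_torsion gen_torsion.
exists k => //; exists (finite_zmod s_all).
have [c cP] := choice gene.
have c_uniq x b : x - combination e b \in @torsion A -> c x = b.
  move=> xb; apply/eqP; rewrite -subr_eq0; apply/eqP/freee.
  rewrite combinationB (_ : _ - _ =
      (x - combination e b) - (x - combination e (c x))).
    by apply: rpredB => //; exact: cP.
  by rewrite opprB [RHS]addrC addrA subrK.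
have [t tE] : exists t : A -> subgroup (@torsion A),
    forall x, val (t x) = x - combination e (c x).
  by exists (fun x => Sub (x - combination e (c x)) (cP x)).
pose phi x : 'rV[int]_k * finite_zmod s_all := (c x, t x).
have cD : {morph c : x y / x + y}.
  move=> x y; apply: c_uniq.
  by rewrite combinationD opprD addrACA; apply: rpredD; exact: cP.
have tD : {morph t : x y / x + y}.
  by move=> x y; apply/val_inj; rewrite /= !tE cD combinationD opprD addrACA.
have phiD : {morph phi : x y / x + y} by move=> x y; rewrite /phi cD tD.
have [f fE] := additive_of phiD; exists f.
exists (fun u => combination e u.1 + val (u.2 : subgroup _)) => [x|[b u]].
  by rewrite fE/= tE addrC subrK.
have cb : c (combination e b + val (u : subgroup _)) = b.
  by apply: c_uniq; rewrite addrAC subrr add0r; exact: valP.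
rewrite fE /phi/= cb; congr (_, _); apply/val_inj.
by rewrite tE cb addrAC subrr add0r.
Qed.
End Structure.

Lemma generated_finitely_generated (A : zmodType) n (g : 'I_n -> A) :
  (forall x, exists c, x = combination g c) -> finitely_generated A.
Proof.
move=> gen; exists [tuple g j | j < n] => x; have [c ->] := gen x.
rewrite /combination; under eq_bigr => j _.
  rewrite -[g j](tnth_mktuple (fun j => g j)) (tnth_nth 0); over.
case: [tuple g j | j < n] => s /= /eqP sn.
by rewrite -sn in c *; exists (c ord0).
Qed.

Section Span.
Variables (G : zmodType) (n : nat) (g : 'I_n -> G).

Definition spanned : {pred G} := fun x => `[< exists c, x = combination g c >].

Lemma spannedP x : reflect (exists c, x = combination g c) (x \in spanned).
Proof. exact: asboolP. Qed.

Lemma spanned_zmod_closed : zmod_closed spanned.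
Proof.
split; first by apply/spannedP; exists 0; rewrite combination0.
move=> _ _ /spannedP[c ->] /spannedP[d ->]; apply/spannedP; exists (c - d).
by rewrite combinationB.
Qed.

HB.instance Definition _ :=
  GRing.isZmodClosed.Build G spanned spanned_zmod_closed.

Lemma mem_spanned j : g j \in spanned.
Proof.
apply/spannedP; exists (delta_mx ord0 j).
rewrite /combination (bigD1 j)//= big1.
  by rewrite mxE !eqxx addr0.
by move=> i ij; rewrite mxE (negPf ij) andbF mulr0z.
Qed.

Lemma spanned_generated (x : subgroup spanned) :
  exists c,
    x = combination (fun j => Sub (g j) (mem_spanned j) : subgroup spanned) c.
Proof.
have /spannedP[c xE] := valP x; exists c; apply/val_inj.
rewrite xE /combination raddf_sum; apply: eq_bigr => j _.
by rewrite raddfMz.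
Qed.

Lemma spanned_finitely_generated : finitely_generated (subgroup spanned).
Proof. exact: generated_finitely_generated spanned_generated. Qed.

Lemma spanned_rank_le : rank_le (subgroup spanned) n.
Proof. exact: generated_rank_le spanned_generated. Qed.

End Span.

(** * Varieties and their dimension *)

Section Varieties.
Variable (R : realType).

Lemma ptws_eval_continuous (X : eqType) (x : X) :
  continuous (fun g : {ptws X -> R[i]^o} => (g x : R[i]^o)).
Proof. exact: (@proj_continuous X (fun=> R[i]^o : topologicalType) x). Qed.

Lemma closed_equations (I X : Type) (L : I -> {ptws X -> R[i]^o} -> R[i]^o) :
  (forall i, continuous (L i)) ->
  closed ([set g | forall i, L i g = 0] : set {ptws X -> R[i]^o}).
Proof.
move=> Lc; rewrite (_ : [set g | _] = \bigcap_(i in setT) (L i @^-1` [set 0])).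
  apply: closed_bigI => i _; apply: closed_comp => [g _|]; first exact: Lc.
  exact/accessible_closed_set1/hausdorff_accessible/norm_hausdorff.
by apply/seteqP; split=> [g gL i _|g gL i]; [exact: gL|exact: (gL i)].
Qed.

Lemma continuous_sum (T : topologicalType) (I : Type) (r : seq I)
    (F : I -> T -> R[i]^o) :
  (forall i, continuous (F i)) -> continuous (fun x => \sum_(i <- r) F i x).
Proof.
move=> Fc; elim: r => [|i r IH] x.
  by under eq_fun do rewrite big_nil; exact: cvg_cst.
under eq_fun do rewrite big_cons.
exact: (@continuousD _ _ _ (F i) (fun x => \sum_(j <- r) F j x)
  x (Fc i x) (IH x)).
Qed.

Section GroupVarieties.
Variable (G : zmodType).

(** Each condition of vanishing of an iterated difference at a point involves
    finitely many values of the function, hence is closed. *)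
Lemma degree_lt_variety n : is_variety [set g : G -> R[i] | degree_lt n g].
Proof.
split=> [|c g h|y g|].
- exact: degree_lt0.
- exact: degree_lt_lin.
- exact: degree_lt_shift.
rewrite (_ : [set g | _] = [set g | forall p : n.-tuple G * G,
    foldr (@difference R G) g p.1 p.2 = 0]).
  apply: closed_equations => -[s x] /=.
  elim: {s}(s : seq G) x => [|y s IH] x /=.
    exact: ptws_eval_continuous.
  by move=> g; apply: continuousB; exact: IH.
apply/seteqP; split=> g /= => [/degree_lt_foldrP gn [s x]|gn].
  by apply: gn; rewrite size_tuple.
by apply/degree_lt_foldrP => s /eqP sn x; exact: (gn (Tuple sn, x)).
Qed.

(** Such an equation confines [g] to the span of the [e k], in a form that
    survives pointwise limits. *)
Lemma addition_formula_variety p (e : 'I_p -> G -> R[i]) (x : 'I_p -> G) :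
  is_variety [set g : G -> R[i] |
    forall s t, g (s + t) = \sum_k e k s * g (x k + t)].
Proof.
split=> [s t|c g h gE hE s t|y g gE s t|].
- by rewrite big1// => k _; rewrite mulr0.
- rewrite !funE gE hE mulr_sumr -big_split/=; apply: eq_bigr => k _.
  by rewrite !funE; ring.
- rewrite -addrA gE; apply: eq_bigr => k _; by rewrite addrA.
rewrite (_ : [set g | _] = [set g : G -> R[i] | forall p : G * G,
    g (p.1 + p.2) - \sum_k e k p.1 * g (x k + p.2) = 0]).
  apply: closed_equations => -[s t]/= g.
  apply: continuousB; first exact: ptws_eval_continuous.
  have Lc k : continuous
      (fun h : {ptws G -> R[i]^o} => (e k s * h (x k + t) : R[i]^o)).
    move=> h; apply: (@continuous_comp _ _ _
        (fun h : {ptws G -> R[i]^o} => (h (x k + t) : R[i]^o))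
        ( *%R (e k s : R[i]^o))).
      exact: ptws_eval_continuous.
    exact: mulrl_continuous.
  exact: (continuous_sum Lc).
apply/seteqP; split=> g /= => [gE [s t]|gE s t]; first by rewrite gE subrr.
by apply/eqP; rewrite -subr_eq0; apply/eqP/(gE (s, t)).
Qed.

End GroupVarieties.

Definition independent_le (X : Type) (V : set (X -> R[i])) (m : nat) : Prop :=
  forall n (v : 'I_n -> X -> R[i]),
    (forall j, V (v j)) -> linearly_independent v -> (n <= m)%N.

(** Evaluation at the points is an injective linear map to a space of dimension
    [#|I|]. *)
Lemma independent_le_points (X : Type) (V : set (X -> R[i])) (I : finType)
    (x : I -> X) :
  (forall (c : R[i]) g h, V g -> V h -> V (c *: g + h)) -> V 0 ->
  (forall g, V g -> (forall k, g (x k) = 0) -> g = 0) -> independent_le V #|I|.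
Proof.
move=> Vlin V0 det n v Vv vfree.
pose A := \matrix_(j < n, k < #|I|) v j (x (enum_val k)).
have Afree : row_free A.
  rewrite -kermx_eq0; apply/eqP/row_matrixP => l; rewrite row0.
  have /rowP cA : row l (kermx A) *m A = 0 by rewrite -row_mul mulmx_ker row0.
  apply/rowP => j; rewrite [RHS]mxE; apply: vfree; apply: det.
    apply: (big_ind V) => // [g h Vg Vh|i _].
      by rewrite -[g]scale1r; exact: Vlin.
    by rewrite -[_ *: _]addr0; exact: Vlin.
  move=> k; have := cA (enum_rank k); rewrite [RHS]mxE mxE => cAk.
  rewrite fct_sumE -[RHS]cAk; apply: eq_bigr => i _.
  by rewrite !mxE enum_rankK.
rewrite -(eqP Afree); exact: rank_leq_col.
Qed.

Lemma dimension_leP (X : Type) (V : set (X -> R[i])) m :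
  (dimension V <= m%:R%:E)%E <-> independent_le V m.
Proof.
split=> [dV n v Vv vfree|Vm].
  rewrite -(ler_nat R) -lee_fin; apply: le_trans dV.
  by apply: ereal_sup_ubound; exists n => //; exists v.
apply: ge_ereal_sup => _ [n [v [Vv vfree]] <-].
by rewrite lee_fin ler_nat; exact: Vm vfree.
Qed.

Lemma variety_dimension_leP (G : zmodType) (f : G -> R[i]) r m :
  (variety_dimension f r <= m%:R%:E)%E <->
  forall H : zmodClosed G, finitely_generated (subgroup H) ->
    rank_le (subgroup H) r ->
    independent_le (variety_of (@restrict_to R G H f)) m.
Proof.
split=> [df H fgH rH|fm].
  apply/dimension_leP; apply: le_trans df.
  by apply: ereal_sup_ubound; exists H.
by apply: ge_ereal_sup => _ [H [fgH rH ->]]; apply/dimension_leP/fm.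
Qed.

Lemma lt_pinfty_nat (x : \bar R) :
  (x < +oo)%E <-> exists m : nat, (x <= m%:R%:E)%E.
Proof.
split=> [|[m xm]]; last by apply: le_lt_trans xm _; rewrite ltry.
case: x => [x _|//|_]; last by exists 0%N; rewrite leNye.
exists (Num.bound `|x|); rewrite lee_fin; apply: le_trans (ler_norm x) _.
exact/ltW/archi_boundP/normr_ge0.
Qed.

End Varieties.

(** * Generalized polynomials on groups of bounded rank *)

Section GridValues.
Variables (R : realType) (G : zmodType).
Implicit Types (f : G -> R[i]) (x y t : G).

(** Along a torsion direction a function of degree less than [n] is polynomial
    in the number of steps and periodic. *)
Lemma degree_lt_torsion n f t : degree_lt n f -> t \in @torsion G ->
  difference t f = 0.
Proof.
move=> fn /torsionP[m m0 tm].
(* This step descends from the [n.+1]-st difference of [f] to the first one. *)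
suff step (h : G -> R[i]) :
    difference t (difference t h) = 0 -> difference t h = 0.
  have : iter n.+1 (difference t) f = 0.
    by apply/funext; apply: degree_lt_eq0; exact: degree_ltS.
  by elim: n {fn} => // n IH /step.
move=> hdd; apply/funext => x; set g := difference t h.
(* [g] is constant along [t], so [h] grows linearly there; periodicity of [h]
   leaves no room for growth. *)
have gx i : g (x + t *+ i) = g x.
  elim: i => [|i IH]; first by rewrite addr0.
  apply/eqP; rewrite -{}IH -subr_eq0 mulrSr addrA.
  exact/eqP/(congr1 (fun u => u (x + t *+ i)) hdd).
have hx i : h (x + t *+ i) = h x + g x *+ i.
  elim: i => [|i IH]; first by rewrite addr0 mulr0n addr0.
  have /eqP := gx i; rewrite {1}/g /difference subr_eq => /eqP gE.
  by rewrite mulrSr addrA gE IH [g x *+ i.+1]mulrSr [RHS]addrA [LHS]addrC.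
have := hx m; rewrite tm addr0 => /esym/eqP.
rewrite -subr_eq0 addrAC subrr add0r.
by rewrite mulrn_eq0 eqn0Ngt m0 => /eqP.
Qed.

(** The difference along [y] vanishes at one point less and has smaller degree,
    so by induction [f] is constant along the line. *)
Lemma degree_lt_line n f x y : degree_lt n f ->
  (forall i, (i < n)%N -> f (x + y *+ i) = 0) ->
  forall a : int, f (x + y *~ a) = 0.
Proof.
elim: n f => [|n IH] f fn f0 a; first exact: fn.
have g0 : forall a : int, difference y f (x + y *~ a) = 0.
  apply: IH; first exact: fn.
  move=> i lin; rewrite /difference -addrA -mulrSr !f0 ?subrr//.
  exact: leqW.
have fS (b : int) : f (x + y *~ (b + 1)) = f (x + y *~ b).
  by apply/eqP; rewrite -subr_eq0 mulrzDr addrA; apply/eqP/g0.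
elim/int_rect: a => [|m IHm|m IHm].
- exact: (f0 0%N).
- by rewrite -[m.+1]addn1 PoszD fS.
- by rewrite -[RHS]IHm -fS -[m.+1]addn1 PoszD opprD subrK.
Qed.

(** One coordinate at a time: the points with the first coordinate on the grid
    are handled by induction, and [degree_lt_line] fills in the first line. *)
Lemma degree_lt_grid n k (e : 'I_k -> G) f x : degree_lt n f ->
  (forall i : 'I_k -> nat, (forall j, (i j < n)%N) ->
     f (x + \sum_j e j *+ i j) = 0) ->
  forall c : 'I_k -> int, f (x + \sum_j e j *~ c j) = 0.
Proof.
move=> fn; elim: k e x => [|k IH] e x f0 c.
  have := f0 (fun=> 0%N); rewrite !big_ord0; apply; by case.
rewrite big_ord_recl addrCA addrC; apply: (degree_lt_line fn) => i0 i0n.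
rewrite addrAC; apply: IH => i iltn.
have := f0 (fun j => oapp i i0 (unlift ord0 j)).
rewrite big_ord_recl unlift_none/= addrA => <-.
  by congr (f (_ + _)); apply: eq_bigr => j _; rewrite liftK.
by move=> j; case: unliftP => [j' _|_]/=.
Qed.
End GridValues.

Lemma has_rank_generates (A : zmodType) k : has_rank A k ->
  exists e : 'I_k -> A, generates_mod_torsion e.
Proof.
move=> [T [phi [psi phiK psiK]]].
exists (fun j => psi (delta_mx ord0 j, 0)) => x; exists (phi x).1.
have phi_comb c :
    phi (combination (fun j => psi (delta_mx ord0 j, 0)) c) = (c, 0).
  rewrite /combination raddf_sum.
  under eq_bigr => j _ do rewrite raddfMz psiK.
  apply/eqP; rewrite -pair_eqE /pair_eq/=; apply/andP; split; apply/eqP.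
    rewrite (raddf_sum (@fst _ _)) [RHS]row_sum_delta.
    by apply: eq_bigr => j _; rewrite (raddfMz (@fst _ _)) /= -scaler_int intz.
  rewrite (raddf_sum (@snd _ _)) big1// => j _.
  by rewrite (raddfMz (@snd _ _)) /= mul0rz.
pose u := (phi x).2 : T.
apply/torsionP; exists #[u]%g; first exact: order_gt0.
apply: (can_inj phiK); rewrite raddfMn raddf0 raddfB phi_comb.
have : u *+ #[u]%g = 0 by rewrite -FinRing.zmodXgE expg_order.
rewrite /u; case: (phi x) => c v /= v0.
have -> : (c, v) - (c, 0) = (0, v) :> 'rV[int]_k * T.
  by congr (_, _); rewrite ?subrr ?subr0.
have -> n : (0, v) *+ n = (0, v *+ n) :> 'rV[int]_k * T.
  by elim: n => // n IH; rewrite !mulrSr IH; congr (_, _); rewrite addr0.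
by rewrite v0.
Qed.

(** Up to torsion, which functions of bounded degree ignore, the group is [Z^k],
    and there the values on a grid of side [n] determine the function. *)
Lemma degree_lt_independent_le (R : realType) (H : zmodType) k n :
  has_rank H k -> independent_le [set g : H -> R[i] | degree_lt n g] (n ^ k).
Proof.
move=> /has_rank_generates[e egen].
rewrite -[X in (_ ^ X)%N](card_ord k) -[X in (X ^ _)%N](card_ord n) -card_ffun.
apply: (@independent_le_points R H _ _
  (fun c : {ffun 'I_k -> 'I_n} => \sum_j e j *+ c j)).
- by move=> c g h; exact: degree_lt_lin.
- exact: degree_lt0.
move=> g gn g0; apply/funext => x; have [c tx] := egen x.
have := congr1 (fun u => u (combination e c)) (degree_lt_torsion gn tx).
rewrite {1}/difference (addrC (combination e c)) subrK => /eqP.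
rewrite subr_eq0 => /eqP ->.
rewrite -[combination e c]add0r; apply: (degree_lt_grid gn) => i iltn.
rewrite add0r; have := g0 [ffun j => Ordinal (iltn j)].
by under eq_bigr do rewrite ffunE.
Qed.

Lemma independent_le_sub (R : realType) (X : Type) (V W : set (X -> R[i])) m n :
  V `<=` W -> (m <= n)%N -> independent_le W m -> independent_le V n.
Proof.
move=> VW mn Wm p v Vv vfree; apply: leq_trans mn.
by apply: (Wm p v) => // j; exact: VW.
Qed.

Lemma restrict_degree_lt (R : realType) (G : zmodType) (H : zmodClosed G) n
    (f : G -> R[i]) : degree_lt n f -> degree_lt n (@restrict_to R G H f).
Proof.
elim: n f => [|n IH] f /= fn; first by move=> x; exact: fn.
by move=> y; exact: (IH (difference (val y) f)).
Qed.

Lemma variety_dimension_of_degree_lt (R : realType) (G : zmodType)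
    (f : G -> R[i]) n r : degree_lt n f -> (variety_dimension f r < +oo)%E.
Proof.
(* [n.+1] instead of [n], for a positive base: the bound [n.+1 ^ k] for rank [k]
   then increases with [k], even if [n] is zero. *)
move=> fn; apply/lt_pinfty_nat; exists (n.+1 ^ r)%N.
apply/variety_dimension_leP => H _ [k kr rk].
apply: (independent_le_sub _ _ (degree_lt_independent_le (n := n.+1) rk)).
  apply: smallest_sub; first exact: degree_lt_variety.
  by move=> _ ->; apply: restrict_degree_lt; exact: degree_ltS.
exact: leq_pexp2l.
Qed.

(** * Bounds on dimensions and the structure of the function *)

(** The number of terms of a Levi-Civita equation bounds the rank of the kernel
    on every subgroup; choosing the skeleton inside the subgroup yields an
    addition formula that passes to the variety. *)
Lemma variety_dimension_of_levi_civita (R : realType) (G : zmodType)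
    (f : G -> R[i]) : levi_civita f ->
  exists m, forall r, (variety_dimension f r <= m%:R%:E)%E.
Proof.
move=> [I [u [v fE]]]; exists #|I| => r.
apply/variety_dimension_leP => H _ _.
pose F := @restrict_to R G H f.
have FE s t : F (s + t) = \sum_i u i (val s) * v i (val t) by rewrite -fE.
have [p [x [y [M [pI KE]]]]] := factorization_skeleton FE.
pose e k s := \sum_l F (s + y l) * M l k.
have W := addition_formula_variety e x.
apply: (independent_le_sub _ pI).
  by apply: smallest_sub; [exact: W|move=> _ -> s t; exact: KE].
have [W0 Wlin _ _] := W.
rewrite -[X in independent_le _ X](card_ord p).
apply: (@independent_le_points R _ _ _ x) => // g gE g0.
apply/funext => s; rewrite -[s]addr0 gE big1// => k _.
by rewrite addr0 g0 mulr0.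
Qed.

Section VarietyOf.
Variables (R : realType) (G : zmodType) (f : G -> R[i]).

Lemma variety_of_id : variety_of f f.
Proof. by move=> V [_ fV]; exact: fV. Qed.

Lemma variety_of_shift y g :
  variety_of f g -> variety_of f (fun x => g (x + y)).
Proof.
by move=> fg V VP; have [[_ _ Vshift _] _] := VP; apply: Vshift; exact: fg.
Qed.

Lemma variety_of_difference y g :
  variety_of f g -> variety_of f (difference y g).
Proof.
move=> fg V VP; have [[_ Vlin Vshift _] _] := VP.
rewrite (_ : difference y g = (-1) *: g + (fun x => g (x + y))).
  by apply: Vlin; [exact: fg|apply: Vshift; exact: fg].
by apply/funext => x; rewrite !funE mulN1r addrC.
Qed.

(** The iterated differences of [f] along [y] form a Jordan chain, so as long as
    they do not vanish they are independent. *)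
Lemma iter_difference_eq0 m d y : independent_le (variety_of f) m ->
  degree_lt d f -> iter m (difference y) f = 0.
Proof.
move=> fm fd; apply: contrapT => fm0.
have : exists q, `[< iter q (difference y) f = 0 >].
  by exists d; apply/asboolP/funext => x; exact: degree_lt_eq0.
move=> /ex_minnP[q /asboolP fq qmin].
have mq : (m < q)%N.
  rewrite ltnNge; apply/negP => qm; apply: fm0.
  by rewrite -(subnK qm) iterD fq iter_difference0.
have fq' : iter q.-1 (difference y) f != 0.
  apply/eqP => fq0; have := qmin q.-1.
  rewrite leqNgt ltn_predL (leq_ltn_trans _ mq)//.
  by move=> /(_ (introT (asboolP _) fq0)).
suff : (m.+1 <= m)%N by rewrite ltnn.
apply: (fm _ (fun j : 'I_m.+1 => iter j (difference y) f)) => [j|c c0].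
  elim: (j : nat) => [|i IH]; first exact: variety_of_id.
  exact: variety_of_difference.
(* The difference iterated [q.-1 - k] times kills all terms above the [k]-th;
   those below have zero coefficient by induction. *)
suff H k (km : (k < m.+1)%N) : c (Ordinal km) = 0.
  by move=> [k km]; exact: H.
have [n] := ubnP k; elim: n k km => // n IH k km kn.
have := congr1 (iter (q.-1 - k) (difference y)) c0.
rewrite iter_difference_sum iter_difference0 (bigD1 (Ordinal km))//= big1.
  rewrite addr0 -iterD subnK; last first.
    by rewrite -ltnS (ltn_predK mq) (leq_trans km).
  move=> /eqP; rewrite scaler_eq0 (negPf fq') orbF => /eqP//.
move=> [j jm] /= jk; have [jlt|] := ltnP j k.
  by rewrite IH ?scale0r//; exact: leq_trans jlt _.
rewrite leq_eqVlt => /orP[/eqP kj|kj].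
  by case/eqP: jk; apply/val_inj.
rewrite -iterD.
have qle : (q <= q.-1 - k + j)%N by lia.
by rewrite -(subnK qle) iterD fq iter_difference0 scaler0.
Qed.

End VarietyOf.

Section Restriction.
Variables (R : realType) (G : zmodType) (f : G -> R[i]) (H : zmodClosed G).

Lemma foldr_restrict (s : seq (subgroup H)) x :
  foldr (@difference R _) (restrict_to f) s x =
  foldr (@difference R _) f (map val s) (val x).
Proof. by elim: s x => //= y s IH x; rewrite /difference !IH. Qed.

Lemma iter_restrict n (y x : subgroup H) :
  iter n (difference y) (restrict_to f) x =
  iter n (difference (val y)) f (val x).
Proof. by elim: n x => //= n IH x; rewrite /difference !IH. Qed.

End Restriction.

(** Both steps test [f] only on subgroups spanned by the points at hand: rank
    two suffices to see the differences along one direction. *)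
Lemma local_polynomial_degree_lt (R : realType) (G : zmodType)
    (f : G -> R[i]) m :
  local_polynomial f -> (variety_dimension f 2 <= m%:R%:E)%E -> degree_lt m f.
Proof.
move=> lf /variety_dimension_leP fm.
have local k (g : 'I_k -> G) :
    exists d, degree_lt d (@restrict_to R G (spanned g) f).
  by apply/polynomial_function_degree_lt/lf/spanned_finitely_generated.
have f0 y x : iter m (difference y) f x = 0.
  pose g := tnth [tuple x; y]; have [d fd] := local _ g.
  pose x' : subgroup (spanned g) := Sub (g ord0) (mem_spanned g ord0).
  pose y' : subgroup (spanned g) :=
    Sub (g (lift ord0 ord0)) (mem_spanned g (lift ord0 ord0)).
  rewrite -[x]/(val x') -[y]/(val y') -iter_restrict.
  rewrite (iter_difference_eq0 y' _ fd)//; apply: fm.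
    exact: spanned_finitely_generated.
  exact: spanned_rank_le.
apply/degree_lt_foldrP => s sm x.
pose g (j : 'I_(size (x :: s))) := (x :: s)`_j; have [d fd] := local _ g.
have mem_g z : z \in x :: s -> z \in spanned g.
  by move=> /(nthP 0)[j jlt <-]; exact: (mem_spanned g (Ordinal jlt)).
pose s' : seq (subgroup (spanned g)) := map (insubd 0) s.
have s'E : map val s' = s.
  rewrite -map_comp map_id_in// => z zs /=; apply: insubdK.
  by apply: mem_g; rewrite inE zs orbT.
have x'E : val (insubd (0 : subgroup (spanned g)) x) = x.
  by apply: insubdK; apply: mem_g; rewrite mem_head.
have fm' : degree_lt m (@restrict_to R G (spanned g) f).
  by apply: degree_lt_iter0 fd _ => y z; rewrite iter_restrict.
have /degree_lt_foldrP/(_ s') := fm'.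
rewrite size_map sm => /(_ erefl (insubd 0 x)).
by rewrite foldr_restrict s'E x'E.
Qed.

(** A nonsingular minor of [f (s + t)] lives on the subgroup spanned by its
    points, where it exhibits independent translates. *)
Lemma levi_civita_of_variety_dimension (R : realType) (G : zmodType)
    (f : G -> R[i]) m :
  (forall r, (variety_dimension f r <= m%:R%:E)%E) -> levi_civita f.
Proof.
move=> fm.
have [[x [y Au]]|[p [x [y [M [_ KE]]]]]] :=
    minor_or_skeleton (fun s t => f (s + t)) m.+1; last first.
  exists 'I_p, (fun k s => \sum_l f (s + y l) * M l k).
  by exists (fun k t => f (x k + t)).
exfalso.
pose g (k : 'I_(m.+1 + m.+1)) :=
  match fintype.split k with inl i => x i | inr j => y j end.
have gx i : g (lshift _ i) = x i by rewrite /g (unsplitK (inl _ i)).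
have gy j : g (rshift _ j) = y j by rewrite /g (unsplitK (inr _ j)).
have mx i : x i \in spanned g by rewrite -gx; exact: mem_spanned.
have my j : y j \in spanned g by rewrite -gy; exact: mem_spanned.
pose F := @restrict_to R G (spanned g) f.
have /variety_dimension_leP/(_ (spanned g)) := fm (m.+1 + m.+1)%N.
move=> /(_ (spanned_finitely_generated g) (spanned_rank_le g)).
move=> /(_ m.+1 (fun j t => F (t + Sub (y j) (my j)))).
suff vfree :
    linearly_independent (fun (j : 'I_m.+1) t => F (t + Sub (y j) (my j))).
  move=> /(_ _ vfree); rewrite ltnn => /(_ _)/notF; apply=> j.
  by apply: variety_of_shift; exact: variety_of_id.
move=> c c0 j.
suff /colP/(_ j) : \col_k c k = 0 by rewrite !mxE.
rewrite -[LHS](mulKmx Au) (_ : _ *m \col_k c k = 0) ?mulmx0//.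
apply/colP => i; rewrite [RHS]mxE mxE.
have c0i := congr1 (fun h => h (Sub (x i) (mx i) : subgroup (spanned g))) c0.
rewrite fct_sumE in c0i; rewrite -[RHS]c0i; apply: eq_bigr => k _.
by rewrite !mxE mulrC funE /F /restrict_to.
Qed.

(** * The three cases *)

Section Classification.
Variables (R : realType) (G : zmodType) (f : G -> R[i]).
Hypothesis lf : local_polynomial f.

Lemma variety_dimension_lim_leP m :
  (limn (variety_dimension f) <= m%:R%:E)%E <->
  forall r, (variety_dimension f r <= m%:R%:E)%E.
Proof.
have cv := ereal_nondecreasing_cvgn (@variety_dimension_nondecreasing R G f).
rewrite (cvg_lim (@ereal_hausdorff R) cv); split=> [dm r|dm].
  by apply: le_trans dm; apply: ereal_sup_ubound; exists r.
by apply: ge_ereal_sup => _ [r _ <-]; exact: dm.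
Qed.

Lemma degree_lt_of_variety_dimension r : (2 <= r)%N ->
  (variety_dimension f r < +oo)%E -> exists n, degree_lt n f.
Proof.
move=> r2 /lt_pinfty_nat[m fm]; exists m.
apply: local_polynomial_degree_lt => //.
by apply: le_trans fm; exact: variety_dimension_nondecreasing.
Qed.

Lemma variety_dimension_lim_polynomial :
  (limn (variety_dimension f) < +oo)%E <-> polynomial_function f.
Proof.
split=> [/lt_pinfty_nat[m /variety_dimension_lim_leP fm]|pf].
  apply: (@polynomial_of_levi_civita _ _ m).
    by apply: local_polynomial_degree_lt => //; exact: fm.
  exact: levi_civita_of_variety_dimension fm.
have [m fm] := variety_dimension_of_levi_civita
  (polynomial_function_levi_civita pf).
by apply/lt_pinfty_nat; exists m; apply/variety_dimension_lim_leP.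
Qed.

Lemma variety_dimension_generalized_polynomial :
  generalized_polynomial f <-> forall r, (variety_dimension f r < +oo)%E.
Proof.
split=> [/generalized_polynomialP[n fn] r|fr].
  exact: variety_dimension_of_degree_lt fn.
apply/generalized_polynomialP.
exact: (degree_lt_of_variety_dimension (leqnn 2)).
Qed.

End Classification.

Unset Implicit Arguments.
Theorem theorem5 (R : realType) (G : zmodType) (f : G -> R[i])
    (hf : local_polynomial f) :
  [/\ (forall r : nat, (2 <= r)%N -> variety_dimension f r = +oo%E) <->
        ~ generalized_polynomial f,
      ((forall r : nat, (0 < r)%N -> (variety_dimension f r < +oo)%E) /\
         limn (variety_dimension f) = +oo%E) <->
        fake_polynomial f &
      (limn (variety_dimension f) < +oo)%E <-> polynomial_function f].
Proof.
have finite_iff := variety_dimension_generalized_polynomial hf.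
have lim_iff := variety_dimension_lim_polynomial hf.
split=> //; split.
- by move=> f_oo /finite_iff/(_ 2%N); rewrite f_oo// ltxx.
- move=> ngp r r2; apply/eqP; rewrite -leye_eq leNgt; apply/negP => fr.
  apply: ngp; apply/generalized_polynomialP.
  exact: (degree_lt_of_variety_dimension hf r2 fr).
- move=> [fr flim]; split; last by move=> /lim_iff; rewrite flim ltxx.
  apply/generalized_polynomialP.
  exact: (degree_lt_of_variety_dimension hf (leqnn 2) (fr 2%N isT)).
move=> [/finite_iff fr np]; split=> //.
apply/eqP; rewrite -leye_eq leNgt; apply/negP => flim.
by apply: np; apply/lim_iff.
Qed.
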